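(* Let $A \in \mathbb{Z}^{m\times n}$, $b \in \mathbb{Z}^m$ and $J \subseteq [n]$. Let $\Gamma = \{\sum_{i=1}^k z_i b^i \mid z_i \in \mathbb{Z}\ \forall i\in[k]\}$ be the lattice generated by rational vectors $b^1,\dots,b^k \in \mathbb{Q}^m$. Consider the infinite family of instances $$\mathrm{IP}(\gamma) = \{x \in \mathbb{R}^n_+ \mid Ax = b+\gamma,\ x_j \in \mathbb{Z} \text{ for } j \in J\}, \qquad \gamma \in \Gamma.$$ Then there exists a finite set $\Lambda \subseteq \mathbb{R}^m$ such that the GMIC closure of every instance $\mathrm{IP}(\gamma)$ can be obtained using aggregation multipliers in $\Lambda$, that is, $$\mathcal{G}(\mathrm{IP}(\gamma)) = \bigcap_{\lambda \in \Lambda} \mathrm{GMIC}\left(\mathrm{IP}(\gamma)_\lambda\right) \quad \forall \gamma \in \Gamma.$$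
   Context: Notation: $[n]=\{1,\dots,n\}$, and $f(u) = u - \lfloor u \rfloor$ for $u \in \mathbb{R}$. Gomory mixed-integer cut (GMIC). For a single-constraint mixed-integer set $$S = \{x \in \mathbb{R}^n_+ \mid \textstyle\sum_{j\in[n]} \alpha_j x_j = \beta,\ x_j \in \mathbb{Z} \text{ for } j \in J\},$$ with $J \subseteq [n]$ and $\beta \notin \mathbb{Z}$, $\mathrm{GMIC}(S)$ denotes the half-space described by the inequality $$\sum_{j \in J,\, f(\alpha_j) \le f(\beta)} \frac{f(\alpha_j)}{f(\beta)} x_j + \sum_{j \in J,\, f(\alpha_j) > f(\beta)} \frac{1-f(\alpha_j)}{1-f(\beta)} x_j + \sum_{j \in [n]\setminus J,\, \alpha_j \ge 0} \frac{\alpha_j}{f(\beta)} x_j + \sum_{j\in[n]\setminus J,\, \alpha_j<0} \frac{-\alpha_j}{1-f(\beta)} x_j \ge 1.$$ If $\beta \in \mathbb{Z}$, then $\mathrm{GMIC}(S)$ is $\mathbb{R}^n_+$. Aggregation. For $\lambda \in \mathbb{R}^m$ (an aggregation multiplier), $$\mathrm{IP}(\gamma)_\lambda = \{x \in \mathbb{R}^n_+ \mid \lambda^\top A x = \lambda^\top (b+\gamma),\ x_j \in \mathbb{Z} \text{ for } j \in J\},$$ so $\mathrm{GMIC}(\mathrm{IP}(\gamma)_\lambda)$ is formed with $\alpha = A^\top\lambda$ and $\beta = \lambda^\top(b+\gamma)$. GMIC closure. $$\mathcal{G}(\mathrm{IP}(\gamma)) = \bigcap_{\lambda \in \mathbb{R}^m}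 \mathrm{GMIC}(\mathrm{IP}(\gamma)_\lambda).$$
   Formalization: The equality of the GMIC closure and the intersection over Λ is proved after intersecting both sides with {x ≥ 0, Ax = b+γ}; as bare intersections of half-spaces it fails, e.g. A=(1), b=0, J={1}, Γ=ℤ. *)

(* Defs.v *)
(* MathComp, with the real numbers as an arbitrary [R : realType]. *)
From HB Require Import structures.
From mathcomp Require Import all_boot all_order all_algebra.
From mathcomp Require Import classical_sets cardinality reals.

Set Implicit Arguments.
Unset Strict Implicit.
Unset Printing Implicit Defensive.

Import Order.TTheory GRing.Theory Num.Theory.
Local Open Scope classical_set_scope.
Local Open Scope ring_scope.

Definition fpart (R : realType) (u : R) : R := u - (Num.floor u)%:~R.

Definition nonneg_orthant (R : realType) (n : nat) : set 'cV[R]_n :=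
  [set x | forall j, 0 <= x j 0].

(* A mixed-integer set is represented by its description: the GMIC cut depends
   on the constraint (e.g. on its scaling), not only on the feasible points. *)
Record mixed_integer_set (R : realType) (m n : nat) := MixedIntegerSet {
  constraint_mx : 'M[R]_(m, n);
  rhs : 'cV[R]_m;
  int_vars : {set 'I_n} }.

(* The system [A x = b, x >= 0] is not implied by the GMIC inequalities: for
   [x >= 0, x = 1, x integer] they only give [x >= 1].  They strengthen this
   relaxation, and GMIC closures are to be compared inside it. *)
Definition linear_relaxation (R : realType) (m n : nat)
    (S : mixed_integer_set R m n) : set 'cV[R]_n :=
  [set x | nonneg_orthant x /\ constraint_mx S *m x = rhs S].

Definition points (R : realType) (m n : nat) (S : mixed_integer_set R m n) :
    set 'cV[R]_n :=
  linear_relaxation S `&`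
  [set x | forall j, j \in int_vars S -> x j 0 \is a Num.int].

Definition GMIC (R : realType) (n : nat) (S : mixed_integer_set R 1 n) :
    set 'cV[R]_n :=
  let alpha j := constraint_mx S 0 j in
  let beta := rhs S 0 0 in
  let J := int_vars S in
  if beta \is a Num.int then @nonneg_orthant R n
  else [set x : 'cV[R]_n |
    \sum_(j in J | fpart (alpha j) <= fpart beta)
       fpart (alpha j) / fpart beta * x j 0
    + \sum_(j in J | fpart beta < fpart (alpha j))
       (1 - fpart (alpha j)) / (1 - fpart beta) * x j 0
    + \sum_(j | (j \notin J) && (0 <= alpha j))
       alpha j / fpart beta * x j 0
    + \sum_(j | (j \notin J) && (alpha j < 0))
       - alpha j / (1 - fpart beta) * x j 0 >= 1].

Definition aggregate (R : realType) (m n : nat) (S : mixed_integer_set R m n)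
    (lambda : 'cV[R]_m) : mixed_integer_set R 1 n :=
  MixedIntegerSet (lambda^T *m constraint_mx S) (lambda^T *m rhs S)
    (int_vars S).

Definition GMIC_closure (R : realType) (m n : nat)
    (S : mixed_integer_set R m n) : set 'cV[R]_n :=
  \bigcap_(lambda in [set: 'cV[R]_m]) GMIC (aggregate S lambda).

Definition IP (R : realType) (m n : nat) (A : 'M[int]_(m, n)) (b : 'cV[int]_m)
    (J : {set 'I_n}) (gamma : 'cV[R]_m) : mixed_integer_set R m n :=
  MixedIntegerSet (map_mx intr A) (map_mx intr b + gamma) J.

(* The generators need not be linearly independent. *)
Definition lattice (R : realType) (m k : nat) (bs : 'I_k -> 'cV[rat]_m) :
    set 'cV[R]_m :=
  [set gamma | exists z : 'I_k -> int,
     gamma = \sum_(i < k) (z i)%:~R *: map_mx ratr (bs i)].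

(* Main.v *)
(* Suppose that [x] in the linear relaxation violates the cut of some multiplier
   [u].  Rounding the coefficients of the cut gives an integer split [(p, p0)]
   whose violation at [x], as a function of the multiplier, is concave,
   piecewise linear and bounded above.  It can therefore be increased until the
   hyperplanes [(u A)_j = p_j] through [u] determine [u A].  The multiplier is
   then a rational solution of a linear system with integer right-hand side,
   and its denominator divides a number [N] that depends on [A] alone.
   If [D] is a common denominator of the generators of the lattice, the scaled
   cut depends only on the multiplier modulo [D] and, monotonically, on the
   positive and negative parts of the coefficients of the continuous variables.
   By Dickson's lemma, finitely many multipliers in [(1/N) Z^m] dominate all
   the others, whatever the right-hand side. *)
Require Import Defs.
From mathcomp Require Import all_boot all_order all_algebra.
From mathcomp Require Import classical_sets cardinality reals.
From mathcomp Require Import boolp ring lra.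
Import Order.TTheory GRing.Theory Num.Theory.
Set Implicit Arguments.
Unset Strict Implicit.
Unset Printing Implicit Defensive.
Local Open Scope classical_set_scope.
Local Open Scope ring_scope.

(** * Dickson's lemma and common denominators *)

(** Induction on the number of functions. With [K] a bound of the first function [F] on the list
    [L0] that works for the others, [L0] dominates every [z] with [K <= F z]. The finitely many
    levels of [F] below [K] are handled one by one, [F] being constant on each. *)
Lemma dickson (X : eqType) (Fs : seq (X -> nat)) (P : X -> Prop) :
  exists L : seq X, (forall z, z \in L -> P z) /\
    forall z, P z -> exists2 z', z' \in L & all (fun F => F z' <= F z)%N Fs.
Proof.
elim: Fs P => [|F Fs IH] P.
  have [[z Pz]|noP] := pselect (exists z, P z).
    exists [:: z]; split=> [y|y _]; first by rewrite inE => /eqP->.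
    by exists z; rewrite ?inE.
  by exists [::]; split=> // z Pz; case: noP; exists z.
have [L0 [L0P L0min]] := IH P.
have [K L0K] : exists K, forall z, z \in L0 -> (F z <= K)%N.
  exists (\max_(z <- L0) F z) => z zL0.
  exact: leq_bigmax_seq.
have [L1 [L1P L1min]] : exists L1 : seq X, (forall z, z \in L1 -> P z) /\
    forall z, P z -> (F z < K)%N ->
      exists2 z', z' \in L1 & all (fun F => F z' <= F z)%N (F :: Fs).
  elim: K {L0K} => [|K [L [LP Lmin]]]; first by exists [::].
  have [L' [L'P L'min]] := IH (fun z => P z /\ F z = K).
  exists (L ++ L'); split=> [z|z Pz].
    by rewrite mem_cat => /orP[/LP|/L'P[]].
  rewrite ltnS leq_eqVlt => /orP[/eqP FzK|/(Lmin _ Pz)[z' z'L minz']].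
    have [z' z'L' minz'] := L'min z (conj Pz FzK).
    exists z'; rewrite ?mem_cat ?z'L' ?orbT //=.
    by have [_ ->] := L'P _ z'L'; rewrite FzK leqnn.
  by exists z'; rewrite ?mem_cat ?z'L.
exists (L0 ++ L1); split=> [z|z Pz].
  by rewrite mem_cat => /orP[/L0P|/L1P].
have [/(L1min _ Pz)[z' z'L minz']|Kz] := ltnP (F z) K.
  by exists z'; rewrite ?mem_cat ?z'L ?orbT.
have [z' z'L minz'] := L0min z Pz.
exists z'; rewrite ?mem_cat ?z'L //= minz' andbT.
exact: leq_trans (L0K _ z'L) Kz.
Qed.

Lemma common_denominator (I : finType) (q : I -> rat) :
  exists2 N : nat, (0 < N)%N & forall i, N%:R * q i \is a Num.int.
Proof.
exists (\prod_i `|denq (q i)|%N) => [|i].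
  by apply: prodn_gt0 => i; rewrite absz_gt0 denq_eq0.
rewrite (bigD1 i) //= natrM mulrAC -[X in _%:R * X](divq_num_den (q i)).
rewrite pmulrn gez0_abs ?denq_ge0 // mulrC rpredM ?rpred_nat //.
by rewrite mulrC mulfVK ?intr_eq0 ?denq_eq0 // intr_int.
Qed.

(** * Moving to a vertex of a polyhedron *)

(** As long as some direction keeps the tight constraints tight and changes [u *m a], moving along
    it without lowering the objective reaches a further constraint. The polyhedron may contain
    lines, so the vertex is determined only up to the kernel of [a]. *)
Lemma polyhedron_vertex (F : realFieldType) (m n : nat) (a : 'M[F]_(m, n))
    (c : 'rV[F]_n) (l : 'cV[F]_m) (M : F) (u0 : 'rV[F]_m) :
  (forall u : 'rV_m, (forall j, c 0 j <= (u *m a) 0 j) -> (u *m l) 0 0 <= M) ->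
  (forall j, c 0 j <= (u0 *m a) 0 j) ->
  exists u : 'rV_m,
    [/\ forall j, c 0 j <= (u *m a) 0 j,
        (u0 *m l) 0 0 <= (u *m l) 0 0 &
        forall v : 'rV_m,
          (forall j, (u *m a) 0 j = c 0 j -> (v *m a) 0 j = 0) -> v *m a = 0].
Proof.
move=> bounded.
have [k] := ubnP #|[pred j | (u0 *m a) 0 j != c 0 j]|.
elim: k u0 => // k IH u0 ltk feas.
set tight := fun v : 'rV_m =>
  forall j, (u0 *m a) 0 j = c 0 j -> (v *m a) 0 j = 0.
have [vert|] := pselect (forall v, tight v -> v *m a = 0).
  by exists u0; split.
move=> /existsNP[v /not_implyP[tv /eqP va]].
have tN w : tight w -> tight (- w).
  by move=> tw j uj; rewrite mulNmx mxE tw ?oppr0.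
have [w [tw lw [j0 wj0]]] : exists w, [/\ tight w, 0 <= (w *m l) 0 0 &
    exists j, (w *m a) 0 j < 0].
  have {va} [j vj] : exists j, (v *m a) 0 j != 0.
    exact/rV0Pn.
  wlog lv : v tv j vj / 0 <= (v *m l) 0 0.
    move=> H; have [lv|lv] := leP 0 ((v *m l) 0 0); first exact: (H v tv j).
    by apply: (H (- v) (tN _ tv) j); rewrite mulNmx mxE ?oppr_eq0 // oppr_ge0 ltW.
  have [lv0|lv0] := eqVneq ((v *m l) 0 0) 0.
    have [vj_lt0|vj_ge0] := ltP ((v *m a) 0 j) 0.
      by exists v; split=> //; exists j.
    exists (- v); rewrite !mulNmx mxE lv0 oppr0; split=> //; first exact: tN.
    by exists j; rewrite mxE oppr_lt0 lt_neqAle eq_sym vj.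
  exists v; split=> //; apply: contrapT => /forallNP vpos.
  have {}lv0 : 0 < (v *m l) 0 0 by rewrite lt_neqAle eq_sym lv0.
  (* If no coordinate decreases along [v], the whole ray is feasible; this step length brings the
     objective to [M + 1]. *)
  pose t := (M - (u0 *m l) 0 0 + 1) / (v *m l) 0 0.
  have t0 : 0 <= t.
    by rewrite divr_ge0 // addr_ge0 // subr_ge0 bounded.
  have : ((u0 + t *: v) *m l) 0 0 <= M.
    apply: bounded => i; rewrite mulmxDl -scalemxAl mxE [X in _ + X]mxE.
    rewrite ler_wpDr // mulr_ge0 //.
    by have /negP := vpos i; rewrite -leNgt.
  by rewrite mulmxDl -scalemxAl mxE [X in _ + X]mxE divfK ?gt_eqF //; lra.
(* Ratio test: [r j] is the step length at which constraint [j] becomes tight, and the smallest one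
   keeps all the others satisfied. *)
pose r j := ((u0 *m a) 0 j - c 0 j) / - (w *m a) 0 j.
have [j1 wj1 minj1] := @Order.TotalTheory.arg_minP _ _ _ j0 (fun j => (w *m a) 0 j < 0) r wj0.
pose u1 : 'rV_m := u0 + r j1 *: w.
have u1E j : (u1 *m a) 0 j = (u0 *m a) 0 j + r j1 * (w *m a) 0 j.
  by rewrite mulmxDl -scalemxAl mxE [X in _ + X]mxE.
have r_ge0 : 0 <= r j1.
  by rewrite divr_ge0 ?subr_ge0 ?feas // oppr_ge0 ltW.
have feas1 j : c 0 j <= (u1 *m a) 0 j.
  rewrite u1E; have [wj|wj] := ltP ((w *m a) 0 j) 0.
    have := minj1 j wj; rewrite {2}/r ler_pdivlMr ?oppr_gt0 // => ?; lra.
  by rewrite ler_wpDr ?feas // mulr_ge0.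
have lt1 : (#|[pred j | ((u1 *m a) 0 j != c 0 j)%R]|
            < #|[pred j | ((u0 *m a) 0 j != c 0 j)%R]|)%N.
  apply: proper_card; apply/properP; split.
    apply/fintype.subsetP => j; rewrite !inE; apply: contraNN => /eqP tj.
    by rewrite u1E (tw j tj) mulr0 addr0 tj.
  exists j1; rewrite inE.
    by apply/eqP => /tw wj; rewrite wj ltxx in wj1.
  have wj_neq0 : (w *m a) 0 j1 != 0 by rewrite lt_eqF.
  rewrite negbK u1E /r; apply/eqP; field.
  by rewrite ?oppr_eq0 wj_neq0.
have [u [feasu lu vertu]] := IH u1 (leq_trans lt1 ltk) feas1.
exists u; split=> //; apply: le_trans lu.
have -> : (u1 *m l) 0 0 = (u0 *m l) 0 0 + r j1 * (w *m l) 0 0.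
  by rewrite mulmxDl -scalemxAl mxE [X in _ + X]mxE.
by rewrite ler_wpDr // mulr_ge0.
Qed.

(** * Fractional parts and the scaled coefficients of the cut *)

Lemma fpart_ge0 (R : realType) (a : R) : 0 <= fpart a.
Proof. by rewrite subr_ge0 floor_le. Qed.

Lemma fpart_lt1 (R : realType) (a : R) : fpart a < 1.
Proof. by have := floorD1_gt a; rewrite /fpart intrD; lra. Qed.

Lemma fpart_gt0 (R : realType) (a : R) : a \isn't a Num.int -> 0 < fpart a.
Proof.
move=> aNint; rewrite lt_neqAle fpart_ge0 andbT eq_sym subr_eq0.
by rewrite eq_sym -intrEfloor.
Qed.

Lemma fpart_shift (R : realType) (a b : R) :
  a - b \is a Num.int -> fpart a = fpart b.
Proof.
move=> abint; rewrite -(subrK b a) /fpart floorDzr // intrD floorK //; ring.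
Qed.

(** The scaled coefficient of a continuous variable; at [a - p] it is the one that a split with
    coefficient [p] produces. *)
Definition split_coef (R : realType) (f a : R) : R :=
  (1 - f) * Num.max a 0 + f * Num.max (- a) 0.

(* The coefficient in the GMIC inequality scaled by [f * (1 - f)]. *)
Definition gmic_coef (R : realType) (integral : bool) (f a : R) : R :=
  if integral then Num.min ((1 - f) * fpart a) (f * (1 - fpart a))
  else split_coef f a.

(** [split_coef f] is monotone on each side of 0, so the best integers [p] are the two neighbours
    [floor a] and [floor a + 1]; they give the two terms of the minimum. *)
Lemma gmic_coef_le_split (R : realType) (integral : bool) (f a : R) (p : int) :
  0 <= f <= 1 -> (~~ integral -> p = 0) ->
  gmic_coef integral f a <= split_coef f (a - p%:~R).
Proof.
move=> /andP[f0 f1]; rewrite /gmic_coef /split_coef.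
case: integral => [_|/(_ isT)->]; last by rewrite subr0.
have [|] := leP p (Num.floor a); last rewrite -lezD1; rewrite -(ler_int R).
  move=> pa; rewrite ge_min; apply/orP; left.
  have ? := @fpart_ge0 _ a.
  apply: ler_wpDr; first by rewrite mulr_ge0 // le_max lexx orbT.
  by apply: ler_wpM2l; rewrite ?subr_ge0 // le_max /fpart lerB.
rewrite intrD => pa; rewrite ge_min; apply/orP; right.
apply: ler_wpDl; first by rewrite mulr_ge0 ?subr_ge0 // le_max lexx orbT.
by apply: ler_wpM2l => //; rewrite le_max /fpart; apply/orP; left; lra.
Qed.

Lemma gmic_coef_split (R : realType) (integral : bool) (f a : R) :
  exists p : int, (~~ integral -> p = 0) /\
    gmic_coef integral f a = split_coef f (a - p%:~R).
Proof.
rewrite /gmic_coef /split_coef; case: integral; last first.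
  by exists 0; rewrite subr0.
have ? := @fpart_ge0 _ a; have ? := @fpart_lt1 _ a.
rewrite minEle; case: ifP => _.
  exists (Num.floor a); split=> //.
  by rewrite -/(fpart a) max_l // max_r ?oppr_le0 // mulr0 addr0.
exists (Num.floor a + 1); split=> //.
have -> : a - (Num.floor a + 1)%:~R = - (1 - fpart a) :> R.
  by rewrite intrD /fpart; ring.
by rewrite opprK max_r ?max_l ?mulr0 ?add0r // ?oppr_le0 subr_ge0 ltW.
Qed.

(** The case distinction on integer variables becomes a minimum: [fpart a <= f] holds exactly when
    [(1 - f) * fpart a <= f * (1 - fpart a)]. *)
Lemma GMICP (R : realType) (n : nat) (S : mixed_integer_set R 1 n)
    (x : 'cV[R]_n) (f := fpart (rhs S 0 0)) : rhs S 0 0 \isn't a Num.int ->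
  GMIC S x <-> f * (1 - f) <=
    \sum_j gmic_coef (j \in int_vars S) f (constraint_mx S 0 j) * x j 0.
Proof.
move=> bNint; rewrite /GMIC (negbTE bNint) /= -/f.
have f0 : 0 < f := fpart_gt0 bNint.
have f1 : 0 < 1 - f by rewrite subr_gt0 fpart_lt1.
rewrite -[X in X <= _ <-> _]/1 -[f * _]mul1r -ler_pdivlMr ?mulr_gt0 //.
set lhs := (X in 1 <= X <-> _); set rhs' := (X in _ <-> 1 <= X).
suff -> : lhs = rhs' by [].
rewrite {}/lhs {}/rhs' mulr_suml.
rewrite [X in X + _ + _ + _]big_mkcond [X in _ + X + _ + _]big_mkcond.
rewrite [X in _ + _ + X + _]big_mkcond [X in _ + _ + _ + X]big_mkcond.
rewrite -!big_split /=.
apply: eq_bigr => j _; set a := constraint_mx S 0 j.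
have f_neq0 : f != 0 by rewrite gt_eqF.
have f1_neq0 : 1 - f != 0 by rewrite gt_eqF.
have [jJ|jJ] := boolP (j \in _); rewrite /gmic_coef /split_coef /=.
  rewrite !addr0; have [ltfa|leaf] := ltP f (fpart a).
    rewrite min_r; last nra.
    rewrite add0r; field; exact/andP.
  rewrite min_l; last nra.
  rewrite addr0; field; exact/andP.
rewrite !add0r; have [a0|a0] := leP 0 a.
  rewrite max_r ?oppr_le0 //; field; exact/andP.
rewrite max_l ?oppr_ge0 ?ltW //; field; exact/andP.
Qed.

(** * Violated cuts and split disjunctions *)

Definition gmic_violated (R : realType) (m n : nat) (A : 'M[R]_(m, n))
    (J : {set 'I_n}) (d : 'cV[R]_m) (x : 'cV[R]_n) (u : 'rV[R]_m) : Prop :=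
  let f := fpart ((u *m d) 0 0) in
  (u *m d) 0 0 \isn't a Num.int /\
  \sum_j gmic_coef (j \in J) f ((u *m A) 0 j) * x j 0 < f * (1 - f).

(* The violation, scaled by [f * (1 - f)], of the inequality that the row
   [a *m x] yields for the disjunction [p x <= p0] or [p x >= p0 + 1]; in this
   form it is visibly concave in [a]. *)
Definition split_gap (R : realType) (n : nat) (x : 'cV[R]_n) (p : 'I_n -> int)
    (p0 : int) (a : 'rV[R]_n) : R :=
  ((a *m x) 0 0 - p0%:~R) * (1 + p0%:~R - \sum_j (p j)%:~R * x j 0)
  - \sum_j Num.max (a 0 j - (p j)%:~R) 0 * x j 0.

(** Both forms come from [max b 0 - max (- b) 0 = b], summed against [x]. *)
Lemma split_gapE (R : realType) (n : nat) (x : 'cV[R]_n) (p : 'I_n -> int)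
    (p0 : int) (a : 'rV[R]_n) (f := (a *m x) 0 0 - p0%:~R) :
  split_gap x p p0 a =
    f * (1 - f) - \sum_j split_coef f (a 0 j - (p j)%:~R) * x j 0 /\
  split_gap x p p0 a =
    (1 - f) * (\sum_j (p j)%:~R * x j 0 - p0%:~R)
    - \sum_j Num.max (- (a 0 j - (p j)%:~R)) 0 * x j 0.
Proof.
rewrite /split_gap -/f.
set y := \sum_j _ * _; set s1 := \sum_j Num.max _ _ * _.
set s2 := \sum_j Num.max (- _) _ * _.
have -> : \sum_j split_coef f (a 0 j - (p j)%:~R) * x j 0
          = (1 - f) * s1 + f * s2.
  rewrite !mulr_sumr -big_split; apply: eq_bigr => j _ /=.
  by rewrite /split_coef; ring.
have s12 : s1 - s2 = f + p0%:~R - y.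
  rewrite /f subrK mxE -!sumrB; apply: eq_bigr => j _.
  rewrite -mulrBl -mulrBl; congr (_ * _).
  have [b0|b0] := leP 0 (a 0 j - (p j)%:~R).
    by rewrite max_r ?oppr_le0 // subr0.
  by rewrite max_l ?oppr_ge0 ?ltW // sub0r opprK.
by have -> : s1 = s2 + f + p0%:~R - y; [lra | split; ring].
Qed.

(** The gap is at most [(1 - f) * y] and at most [f * (1 - y)], so a violated split has [x] strictly
    between its two sides. *)
Lemma split_gap_gt0 (R : realType) (n : nat) (x : 'cV[R]_n) (p : 'I_n -> int)
    (p0 : int) (a : 'rV[R]_n) (f := (a *m x) 0 0 - p0%:~R)
    (y := \sum_j (p j)%:~R * x j 0 - p0%:~R) :
  nonneg_orthant x -> 0 <= f <= 1 -> 0 < split_gap x p p0 a -> 0 < y < 1.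
Proof.
move=> x0 /andP[f0 f1] gap0; have [_ gapE] := split_gapE x p p0 a.
have s1 : 0 <= \sum_j Num.max (a 0 j - (p j)%:~R) 0 * x j 0.
  by apply: sumr_ge0 => j _; rewrite mulr_ge0 ?x0 // le_max lexx orbT.
have s2 : 0 <= \sum_j Num.max (- (a 0 j - (p j)%:~R)) 0 * x j 0.
  by apply: sumr_ge0 => j _; rewrite mulr_ge0 ?x0 // le_max lexx orbT.
apply/andP; split.
  rewrite gapE -/f -/y in gap0; nra.
rewrite /split_gap -/f in gap0; rewrite /y; nra.
Qed.

(** The same two bounds, read with [y] fixed. Since [y] does not depend on [a], they control every
    other multiplier for the same split. *)
Lemma split_gap_rhs (R : realType) (n : nat) (x : 'cV[R]_n) (p : 'I_n -> int)
    (p0 : int) (a : 'rV[R]_n) (f := (a *m x) 0 0 - p0%:~R)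
    (y := \sum_j (p j)%:~R * x j 0 - p0%:~R) :
  nonneg_orthant x -> 0 < y < 1 -> 0 < split_gap x p p0 a ->
  0 < f < 1 /\ split_gap x p p0 a <= 1.
Proof.
move=> x0 /andP[y0 y1] gap0; have [_ gapE] := split_gapE x p p0 a.
have s1 : 0 <= \sum_j Num.max (a 0 j - (p j)%:~R) 0 * x j 0.
  by apply: sumr_ge0 => j _; rewrite mulr_ge0 ?x0 // le_max lexx orbT.
have s2 : 0 <= \sum_j Num.max (- (a 0 j - (p j)%:~R)) 0 * x j 0.
  by apply: sumr_ge0 => j _; rewrite mulr_ge0 ?x0 // le_max lexx orbT.
have f0 : 0 < f.
  by rewrite ltNge; apply/negP => f0; rewrite /split_gap -/f in gap0; rewrite /y in y0 y1; nra.
have f1 : f < 1.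
  by rewrite ltNge; apply/negP => f1; rewrite gapE -/f -/y in gap0; nra.
by rewrite f0 f1; split=> //; rewrite gapE -/f -/y; nra.
Qed.

(** * Reduction to multipliers with a fixed denominator *)

Lemma gmic_violated_rational (R : realType) (m n : nat) (A : 'M[int]_(m, n))
    (J : {set 'I_n}) :
  exists2 N : nat, (0 < N)%N &
    forall (d : 'cV[R]_m) (x : 'cV[R]_n) (u : 'rV[R]_m),
      nonneg_orthant x -> map_mx intr A *m x = d ->
      gmic_violated (map_mx intr A) J d x u ->
      exists z : 'rV[int]_m,
        gmic_violated (map_mx intr A) J d x (N%:R^-1 *: map_mx intr z).
Proof.
(* [T] will be the set of tight columns. There are finitely many, so all pseudo-inverses have a
   common denominator independent of [d] and [x]. *)
pose B (T : {set 'I_n}) : 'M[rat]_(m, n) :=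
  \matrix_(i, j) if j \in T then (A i j)%:~R else 0.
have [N N0 Nint] := common_denominator
  (fun q : {set 'I_n} * 'I_n * 'I_m => pinvmx (B q.1.1) q.1.2 q.2).
exists N => // d x u x0 Axd [udNint viol].
set AR := map_mx intr A : 'M[R]_(m, n).
have udE v : v *m d = v *m AR *m x by rewrite -mulmxA Axd.
have [p pP] := choice (fun j =>
  gmic_coef_split (j \in J) (fpart ((u *m d) 0 0)) ((u *m AR) 0 j)).
pose p0 := Num.floor ((u *m d) 0 0).
pose G v := split_gap x p p0 (v *m AR).
pose y := \sum_j (p j)%:~R * x j 0 - p0%:~R.
have Gu : 0 < G u.
  rewrite /G; have [-> _] := split_gapE x p p0 (u *m AR).
  rewrite -udE -/(fpart _) subr_gt0; move: viol; congr (_ < _).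
  by apply: eq_bigr => j _; have [_ ->] := pP j.
have y01 : 0 < y < 1.
  apply: split_gap_gt0 Gu => //.
  by rewrite -udE -/(fpart _) fpart_ge0 ltW ?fpart_lt1.
(* [2 * s j - 1] is the sign that writes either side of the hyperplane [p j] as a lower bound. *)
pose s j : R := (0 <= (u *m AR) 0 j - (p j)%:~R)%R%:R.
(* [v *m a >= c] is the cell of [u] in the arrangement of the hyperplanes
   [(v *m AR) 0 j = p j]; on it [G] is affine with linear part [l]. *)
pose a : 'M[R]_(m, n) := \matrix_(i, j) ((2 * s j - 1) * AR i j).
pose c : 'rV[R]_n := \row_j ((2 * s j - 1) * (p j)%:~R).
pose l : 'cV[R]_m := (1 - y) *: d - AR *m (\col_j (s j * x j 0)).
pose K : R := - p0%:~R * (1 - y) + \sum_j s j * (p j)%:~R * x j 0.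
have s01 j : s j = 1 \/ s j = 0 by rewrite /s; case: (0 <= _); [left|right].
have aE (v : 'rV_m) j : (v *m a) 0 j = (2 * s j - 1) * (v *m AR) 0 j.
  by rewrite !mxE mulr_sumr; apply: eq_bigr => i _; rewrite !mxE mulrCA.
have GE v : (forall j, c 0 j <= (v *m a) 0 j) -> G v = (v *m l) 0 0 + K.
  move=> cell; rewrite /l mulmxBr -scalemxAr mulmxA mxE.
  rewrite [X in X + _ + K]mxE [X in _ + X + K]mxE [X in _ - X + K]mxE.
  rewrite /G /split_gap -udE.
  have -> : \sum_j Num.max ((v *m AR) 0 j - (p j)%:~R) 0 * x j 0 =
      \sum_j (v *m AR) 0 j * (\col_j (s j * x j 0)) j 0
      - \sum_j s j * (p j)%:~R * x j 0.
    rewrite -sumrB; apply: eq_bigr => j _; rewrite mxE.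
    have := cell j; rewrite aE mxE; have [->|->] := s01 j => ?.
      rewrite max_l; [ring | lra].
    rewrite max_r; [ring | lra].
  rewrite /K /y; ring.
have feas j : c 0 j <= (u *m a) 0 j.
  rewrite aE mxE /s; have [|] := leP 0 ((u *m AR) 0 j - (p j)%:~R) => ? /=; lra.
(* Where [G] is positive it is at most 1. *)
have bounded (v : 'rV_m) :
    (forall j, c 0 j <= (v *m a) 0 j) -> (v *m l) 0 0 <= `|1 - K|.
  move=> /GE Gv; have [Gv0|Gv0] := ltP 0 (G v).
    have [_ Gv1] := split_gap_rhs x0 y01 Gv0.
    by apply: le_trans (ler_norm _); rewrite lerBrDr -Gv.
  apply: le_trans (ler_norm _); rewrite lerBrDr -Gv; lra.
have [w [feasw luw vertw]] := polyhedron_vertex bounded feas.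
pose T : {set 'I_n} := [set j | (w *m a) 0 j == c 0 j]%SET.
have s_neq0 j : 2 * s j - 1 != 0 by have [->|->] := s01 j; apply/eqP; lra.
have TP j : j \in T -> (w *m AR) 0 j = (p j)%:~R.
  by rewrite inE aE [c 0 j]mxE => /eqP /(mulfI (s_neq0 j)).
pose pT : 'rV[int]_n := \row_j if j \in T then p j else 0.
pose BT : 'M[R]_(m, n) := map_mx ratr (B T).
have wBT : w *m BT = map_mx intr pT.
  apply/rowP => j; rewrite !mxE; have [jT|jT] := boolP (j \in T).
    rewrite -TP // mxE; apply: eq_bigr => i _.
    by rewrite !mxE jT ratr_int.
  rewrite big1 ?rmorph0 // => i _.
  by rewrite !mxE (negbTE jT) rmorph0 mulr0.
(* [w] may be irrational; [w'] solves the same tight equations. By the vertex property [w'] and [w]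
   agree after multiplication by [AR], which is all that [G] sees. *)
pose w' : 'rV[R]_m := map_mx intr pT *m map_mx ratr (pinvmx (B T)).
have w'BT : w' *m BT = map_mx intr pT.
  by rewrite /w' map_pinvmx mulmxKpV // -wBT submxMl.
have w'AR : w' *m AR = w *m AR.
  have w'wa : (w' - w) *m a = 0.
    apply: vertw => j tight_j; have jT : j \in T by rewrite inE; apply/eqP.
    rewrite aE; apply/eqP; rewrite mulf_eq0 (negbTE (s_neq0 _)) /=; apply/eqP.
    transitivity (((w' - w) *m BT) 0 j).
      by rewrite !mxE; apply: eq_bigr => i _; rewrite !mxE jT ratr_int.
    by rewrite mulmxBl w'BT wBT subrr mxE.
  apply/rowP => j; apply/eqP; rewrite -subr_eq0; apply/eqP.
  have := congr1 (fun M : 'rV_n => M 0 j) w'wa; rewrite /= aE mulmxBl !mxE.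
  by move=> /eqP; rewrite mulf_eq0 (negbTE (s_neq0 _)) => /eqP.
have Gw' : 0 < G w'.
  rewrite /G w'AR -/(G w) GE //; apply: (lt_le_trans Gu).
  by rewrite GE // lerD2r.
have [z zE] : exists z : 'rV[int]_m, w' = N%:R^-1 *: map_mx intr z.
  exists (\row_i Num.floor (N%:R * w' 0 i)).
  apply/rowP => i; rewrite [RHS]mxE [X in _ * X]mxE [X in X%:~R]mxE floorK.
    by rewrite mulKf // pnatr_eq0 -lt0n.
  rewrite [w' 0 i]mxE mulr_sumr; apply: rpred_sum => j _.
  rewrite [map_mx _ pT 0 j]mxE [X in _ * (_ * X)]mxE mulrCA.
  rewrite rpredM ?intr_int //.
  have /intrP[q /= qE] := Nint (T, j, i).
  by rewrite -(ratr_nat R) -rmorphM qE /= ratr_int intr_int.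
exists z; rewrite -zE.
have [f01 _] := split_gap_rhs x0 y01 Gw'.
move: f01; rewrite -udE => /andP[f0 f1].
(* As [0 < f < 1], the side [p0] of the split is still the floor of the new right-hand side. *)
have floorw' : Num.floor ((w' *m d) 0 0) = p0.
  by apply: floor_def; rewrite intrD; apply/andP; split; lra.
have fE : fpart ((w' *m d) 0 0) = (w' *m d) 0 0 - p0%:~R.
  by rewrite /fpart floorw'.
split.
  by rewrite intrEfloor floorw' -subr_eq0 lt_eqF // -opprB oppr_lt0.
rewrite fE; move: Gw'; rewrite /G.
have [-> _] := split_gapE x p p0 (w' *m AR); rewrite -udE subr_gt0.
(* The cut of [w'] rounds optimally, so it is violated at least as much as the split [(p, p0)]. *)
apply: le_lt_trans; apply: ler_sum => j _; rewrite ler_wpM2r ?x0 //.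
apply: gmic_coef_le_split; first by apply/andP; split; exact: ltW.
by have [] := pP j.
Qed.

(** * Domination between multipliers *)

Lemma gmic_coef_le (R : realType) (integral : bool) (f a a' : R) :
  0 <= f <= 1 -> fpart a' = fpart a -> Num.max a' 0 <= Num.max a 0 ->
  Num.max (- a') 0 <= Num.max (- a) 0 ->
  gmic_coef integral f a' <= gmic_coef integral f a.
Proof.
move=> /andP[f0 f1] faa' pos neg; rewrite /gmic_coef faa'; case: integral => //.
by rewrite /split_coef lerD // ler_wpM2l // subr_ge0.
Qed.

(** Congruence of the numerators modulo [D * N] makes the multipliers differ by [D] times an integer
    vector, hence all coefficients and the right-hand sides by integers. *)
Lemma gmic_violated_dominated (R : realType) (m n : nat) (A : 'M[int]_(m, n))
    (J : {set 'I_n}) (d : 'cV[R]_m) (x : 'cV[R]_n) (D N : nat)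
    (z z' : 'rV[int]_m) :
  nonneg_orthant x -> (0 < N)%N -> (forall i, D%:R * d i 0 \is a Num.int) ->
  (forall i, (z' 0%R i = z 0%R i %[mod (D * N)%N])%Z) ->
  (forall j, Num.max ((z' *m A) 0 j) 0 <= Num.max ((z *m A) 0 j) 0) ->
  (forall j, Num.max (- (z' *m A) 0 j) 0 <= Num.max (- (z *m A) 0 j) 0) ->
  gmic_violated (map_mx intr A) J d x (N%:R^-1 *: map_mx intr z) ->
  gmic_violated (map_mx intr A) J d x (N%:R^-1 *: map_mx intr z').
Proof.
move=> x0 N0 Dd zmod pos neg.
have N_gt0 : 0 < N%:R :> R by rewrite ltr0n.
have N_neq0 : N%:R != 0 :> R by rewrite gt_eqF.
set u := _ *: map_mx intr z; set u' := _ *: map_mx intr z'.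
have [w u'E] : exists w : 'rV[int]_m, u' = u + D%:R *: map_mx intr w.
  exists (\row_i ((z' 0%R i - z 0%R i)%R %/ (D * N)%N)%Z).
  apply/rowP => i; rewrite !mxE; apply: (mulfI N_neq0).
  have /divzK zK : ((D * N)%N %| (z' 0%R i - z 0%R i)%R)%Z.
    by rewrite -eqz_mod_dvd; apply/eqP.
  have := congr1 (fun k : int => k%:~R : R) zK.
  rewrite rmorphM rmorphB /= -pmulrn natrM => zKR.
  by rewrite mulrDr !mulVKf //; lra.
have u'A j : (u' *m map_mx intr A) 0 j - (u *m map_mx intr A) 0 j \is a Num.int.
  rewrite u'E mulmxDl -scalemxAl -map_mxM /= !mxE [X in X - _]addrC addrK.
  by rewrite rpredM ?rpred_nat ?intr_int.
have u'd : (u' *m d) 0 0 - (u *m d) 0 0 \is a Num.int.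
  rewrite u'E mulmxDl mxE [X in X - _]addrC addrK -scalemxAl mxE mxE mulr_sumr.
  by apply: rpred_sum => i _; rewrite mulrCA rpredM // mxE intr_int.
have scale (q r : int) : Num.max q 0 <= Num.max r 0 ->
    Num.max (N%:R^-1 * q%:~R) 0 <= Num.max (N%:R^-1 * r%:~R) 0 :> R.
  rewrite !ge_max !le_max !lexx !orbT !andbT => /orP[qr|q0]; apply/orP.
    by left; rewrite ler_pM2l ?invr_gt0 // ler_int.
  by right; rewrite pmulr_rle0 ?invr_gt0 // lerz0.
have uA (v : 'rV[int]_m) j :
    ((N%:R^-1 *: map_mx intr v) *m map_mx intr A) 0 j
    = N%:R^-1 * ((v *m A) 0 j)%:~R :> R.
  by rewrite -scalemxAl -map_mxM mxE [X in _ * X]mxE.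
case=> udNint viol; split.
  by apply: contra udNint => u'dint; rewrite -(rpredBl _ u'dint) // opprB.
rewrite (fpart_shift u'd); apply: le_lt_trans viol.
apply: ler_sum => j _; rewrite ler_wpM2r ?x0 //.
apply: gmic_coef_le; first by rewrite fpart_ge0 ltW ?fpart_lt1.
- exact: fpart_shift.
- by rewrite !uA scale.
- by rewrite !uA -!mulrN -!intrN scale.
Qed.

(** * The finite set of multipliers *)

Lemma GMIC_aggregateP (R : realType) (m n : nat) (S : mixed_integer_set R m n)
    (x : 'cV[R]_n) (lambda : 'cV[R]_m) : nonneg_orthant x ->
  ~ GMIC (aggregate S lambda) x <->
  gmic_violated (constraint_mx S) (int_vars S) (rhs S) x lambda^T.
Proof.
move=> x0; rewrite /gmic_violated.
have [bint|bNint] := boolP (rhs (aggregate S lambda) 0 0 \is a Num.int).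
  by rewrite /GMIC bint; split=> [|[]] //; rewrite -[_ \isn't _]/(~~ _) bint.
split=> [viol|[_ viol] /(GMICP _ bNint)]; last by rewrite leNgt viol.
by split=> //; rewrite ltNge; apply/negP => /(GMICP _ bNint).
Qed.

Theorem theorem1 (R : realType) (m n k : nat) (A : 'M[int]_(m, n))
    (b : 'cV[int]_m) (J : {set 'I_n}) (bs : 'I_k -> 'cV[rat]_m) :
  exists Lambda : set 'cV[R]_m,
    finite_set Lambda /\
    forall gamma : 'cV[R]_m, lattice bs gamma ->
      linear_relaxation (IP A b J gamma) `&` GMIC_closure (IP A b J gamma) =
      linear_relaxation (IP A b J gamma) `&`
        \bigcap_(lambda in Lambda) GMIC (aggregate (IP A b J gamma) lambda).
Proof.
have [N N0 ratl] := @gmic_violated_rational R m n A J.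
have [D D0 Dint] := common_denominator (fun q : 'I_k * 'I_m => bs q.1 q.2 0).
pose M : int := (D * N)%N.
pose residue i (z : 'rV[int]_m) := absz (z 0%R i %% M)%Z.
(* Domination only gives inequalities; recording the residue and its complement to [M] forces equal
   residues. *)
pose coresidue i (z : 'rV[int]_m) := absz (M - (z 0%R i %% M)%Z).
pose pos j (z : 'rV[int]_m) := absz (Num.max ((z *m A) 0 j) 0).
pose neg j (z : 'rV[int]_m) := absz (Num.max (- (z *m A) 0 j) 0).
have all_ordP q T (P : pred T) (F : 'I_q -> T) :
    all P (map F (enum 'I_q)) -> forall i, P (F i).
  by rewrite all_map => /allP PF i; apply: PF; rewrite mem_enum.
have [L [_ Lmin]] := dickson (map residue (enum 'I_m) ++ map coresidue (enum 'I_m)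
  ++ map pos (enum 'I_n) ++ map neg (enum 'I_n)) (fun=> True).
pose mult (z : 'rV[int]_m) : 'cV[R]_m := (N%:R^-1 *: map_mx intr z)^T.
exists [set` map mult L]; split=> [|gamma [c gammaE]]; first exact: finite_seq.
apply/seteqP; split=> x /= [relx clx]; split=> //.
  by move=> lambda _; apply: clx.
move=> lambda _; apply: contrapT => viol.
have [x0 Axd] := relx.
have [z violz] := ratl _ _ _ x0 Axd (iffLR (GMIC_aggregateP _ _ x0) viol).
have [z' z'L] := Lmin z I.
rewrite !all_cat => /and4P[/all_ordP res /all_ordP cores /all_ordP lepos
  /all_ordP leneg].
have := clx (mult z') (map_f mult z'L).
apply: (iffRL (GMIC_aggregateP _ _ x0)); rewrite trmxK /=.
have M_gt0 : 0 < M by rewrite ltz_nat muln_gt0 D0.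
have M_neq0 : M != 0 by rewrite gt_eqF.
have ge0_le (p q : int) : 0 <= p -> 0 <= q -> (`|p| <= `|q|)%N -> p <= q.
  by move=> p0 q0; rewrite -lez_nat !gez0_abs.
apply: (@gmic_violated_dominated _ _ _ _ _ _ _ D _ _ _ x0 N0 _ _ _ _ violz).
- move=> i; rewrite mxE mulrDr rpredD //.
    by rewrite mxE rpredM ?rpred_nat ?intr_int.
  rewrite gammaE summxE mulr_sumr rpred_sum // => q _.
  rewrite !mxE mulrCA rpredM ?intr_int //.
  have /intrP[e /= eE] := Dint (q, i).
  by rewrite -(ratr_nat R) -rmorphM eE /= ratr_int intr_int.
- move=> i; apply/eqP; rewrite eq_le; apply/andP; split.
    by apply: ge0_le; rewrite ?modz_ge0 //; exact: (res i).
  rewrite -lerN2 -(lerD2l M); apply: ge0_le; rewrite ?subr_ge0.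
  + exact/ltW/ltz_pmod.
  + exact/ltW/ltz_pmod.
  + exact: (cores i).
- move=> j; apply: ge0_le; rewrite ?le_max ?lexx ?orbT //.
  exact: (lepos j).
- move=> j; apply: ge0_le; rewrite ?le_max ?lexx ?orbT //.
  exact: (leneg j).
Qed.
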